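(* Let $\mathcal X_1,\mathcal X_2,\mathcal Y_1,\mathcal Y_2,\mathcal W_1,\mathcal W_2$ be finite nonempty sets, let $g_1:\mathcal W_1\times\mathcal X_1\to[0,1]$ and $g_2:\mathcal W_2\times\mathcal X_2\to[0,1]$ be gain functions, and let $g:(\mathcal W_1\times\mathcal W_2)\times(\mathcal X_1\times\mathcal X_2)\to[0,1]$ be a joint gain function for $g_1,g_2$. For any prior $\pi$ on $\mathcal X_1\times\mathcal X_2$ with marginals $\pi_1$ and $\pi_2$ and with $V_g(\pi)>0$, and any two channels $(\mathcal X_1,\mathcal Y_1,C_1)$ and $(\mathcal X_2,\mathcal Y_2,C_2)$: (1) $H_g(\pi,C_1\times C_2)\ \ge\ H_{g_1}(\pi_1,C_1)+H_{g_2}(\pi_2,C_2)+\log M^{\min}_{g,\pi}$; (2) if $\pi$ is jointly supported, $H_g(\pi,C_1\times C_2)\ \le\ H_{g_1}(\pi_1,C_1)+H_{g_2}(\pi_2,C_2)+\log M^{\max}_{g,\pi}$.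
   Context: A (discrete) channel $(\mathcal X,\mathcal Y,C)$ consists of finite sets $\mathcal X,\mathcal Y$ and a matrix $C$ with entries $C[x,y]\ge 0$ and $\sum_{y}C[x,y]=1$ for each $x$. A prior on $\mathcal X$ is a probability distribution on $\mathcal X$. The parallel composition (with distinct inputs) $C_1\times C_2$ is the channel from $\mathcal X_1\times\mathcal X_2$ to $\mathcal Y_1\times\mathcal Y_2$ with $(C_1\times C_2)[(x_1,x_2),(y_1,y_2)]=C_1[x_1,y_1]\,C_2[x_2,y_2]$. For a gain function $g:\mathcal W\times\mathcal X\to[0,1]$: $V_g(\pi)=\max_{w\in\mathcal W}\sum_{x}\pi[x]g(w,x)$, $V_g(\pi,C)=\sum_{y}\max_{w\in\mathcal W}\sum_x\pi[x]C[x,y]g(w,x)$, and $H_g(\pi,C)=-\log V_g(\pi,C)$. Logarithms are to base 2. A joint gain function $g$ for $g_1,g_2$ is required to satisfy: $g((w_1,w_2),(x_1,x_2))=0$ if and only if $g_1(w_1,x_1)g_2(w_2,x_2)=0$ (no other relation is assumed). The marginals of $\pi$ are $\pi_1[x_1]=\sum_{x_2}\pi[x_1,x_2]$ and $\pi_2[x_2]=\sum_{x_1}\pi[x_1,x_2]$. $\pi$ is jointly supported if for all $x_1,x_2$, $\pi_1[x_1]\pi_2[x_2]\ne 0$ implies $\pi[x_1,x_2]\neq 0$. For $w_1\in\mathcal W_1,w_2\in\mathcal W_2$ let $\mathcal S_{w_1,w_2}=\{(x_1,x_2):\pi[x_1,x_2]\,g((w_1,w_2),(x_1,x_2))\ne0\}$.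 Define $M^{\min}_{g,\pi}$ (resp. $M^{\max}_{g,\pi}$) as the minimum (resp. maximum), over all $(w_1,w_2)\in\mathcal W_1\times\mathcal W_2$ and all $(x_1,x_2)\in\mathcal S_{w_1,w_2}$, of $$\frac{\pi_1[x_1]g_1(w_1,x_1)\cdot\pi_2[x_2]g_2(w_2,x_2)}{\pi[x_1,x_2]\cdot g((w_1,w_2),(x_1,x_2))}.$$ Pairs $(w_1,w_2)$ with $\mathcal S_{w_1,w_2}=\emptyset$ are ignored; $V_g(\pi)>0$ guarantees that some $\mathcal S_{w_1,w_2}$ is nonempty. *)

(* Defs.v *)
From HB Require Import structures.
From mathcomp Require Import all_boot all_order all_algebra.
From mathcomp Require Import reals exp.

Set Implicit Arguments.
Unset Strict Implicit.
Unset Printing Implicit Defensive.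

Import Order.TTheory GRing.Theory Num.Theory.
Local Open Scope ring_scope.

Section FiniteExtrema.
Variables (R : realType) (I : finType).
Implicit Types (P : pred I) (F : I -> R).

(* Maximum and minimum of F over the indices satisfying P. The value 0 is
   returned only when no index satisfies P; see fmaxP and fminP. *)
Definition fmax P F : R :=
  if [pick i | P i] is Some i0 then F [arg max_(i > i0 | P i) F i]%O else 0.

Definition fmin P F : R :=
  if [pick i | P i] is Some i0 then F [arg min_(i < i0 | P i) F i]%O else 0.

Lemma fmaxP P F i0 : P i0 ->
  (exists2 i, P i & fmax P F = F i) /\ (forall i, P i -> F i <= fmax P F).
Proof.
rewrite /fmax; case: pickP => [j Pj _|->//].
by case: arg_maxP => //= i Pi Fi; split; [exists i|].
Qed.

Lemma fminP P F i0 : P i0 ->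
  (exists2 i, P i & fmin P F = F i) /\ (forall i, P i -> fmin P F <= F i).
Proof.
rewrite /fmin; case: pickP => [j Pj _|->//].
by case: arg_minP => //= i Pi Fi; split; [exists i|].
Qed.

End FiniteExtrema.

Definition log2 (R : realType) (x : R) : R := ln x / ln 2.

Definition is_prior (R : realType) (X : finType) (p : X -> R) : Prop :=
  (forall x, 0 <= p x) /\ \sum_x p x = 1.

Definition is_channel (R : realType) (X Y : finType) (C : X -> Y -> R) : Prop :=
  (forall x y, 0 <= C x y) /\ (forall x, \sum_y C x y = 1).

Definition is_gain (R : realType) (W X : finType) (g : W -> X -> R) : Prop :=
  forall w x, 0 <= g w x <= 1.

Definition is_joint_gain (R : realType) (W1 W2 X1 X2 : finType)
    (g1 : W1 -> X1 -> R) (g2 : W2 -> X2 -> R)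
    (g : W1 * W2 -> X1 * X2 -> R) : Prop :=
  is_gain g /\
  forall w1 w2 x1 x2, g (w1, w2) (x1, x2) = 0 <-> g1 w1 x1 * g2 w2 x2 = 0.

Definition parallel (R : realType) (X1 X2 Y1 Y2 : finType)
    (C1 : X1 -> Y1 -> R) (C2 : X2 -> Y2 -> R) : X1 * X2 -> Y1 * Y2 -> R :=
  fun x y => C1 x.1 y.1 * C2 x.2 y.2.

Definition vuln (R : realType) (W X : finType)
    (g : W -> X -> R) (p : X -> R) : R :=
  fmax predT (fun w : W => \sum_x p x * g w x).

Definition post_vuln (R : realType) (W X Y : finType)
    (g : W -> X -> R) (p : X -> R) (C : X -> Y -> R) : R :=
  \sum_y fmax predT (fun w : W => \sum_x p x * C x y * g w x).

Definition post_entropy (R : realType) (W X Y : finType)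
    (g : W -> X -> R) (p : X -> R) (C : X -> Y -> R) : R :=
  - log2 (post_vuln g p C).

Definition marginal1 (R : realType) (X1 X2 : finType)
    (p : X1 * X2 -> R) : X1 -> R :=
  fun x1 => \sum_x2 p (x1, x2).

Definition marginal2 (R : realType) (X1 X2 : finType)
    (p : X1 * X2 -> R) : X2 -> R :=
  fun x2 => \sum_x1 p (x1, x2).

Definition jointly_supported (R : realType) (X1 X2 : finType)
    (p : X1 * X2 -> R) : Prop :=
  forall x1 x2, marginal1 p x1 * marginal2 p x2 != 0 -> p (x1, x2) != 0.

Definition supp_set (R : realType) (W X : finType)
    (g : W -> X -> R) (p : X -> R) (w : W) : {set X} :=
  [set x | p x * g w x != 0].

Section Ratio.
Variables (R : realType) (W1 W2 X1 X2 : finType).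
Variables (g1 : W1 -> X1 -> R) (g2 : W2 -> X2 -> R).
Variables (g : W1 * W2 -> X1 * X2 -> R) (p : X1 * X2 -> R).

Definition gain_ratio (w : W1 * W2) (x : X1 * X2) : R :=
  (marginal1 p x.1 * g1 w.1 x.1 * (marginal2 p x.2 * g2 w.2 x.2))
  / (p x * g w x).

Definition Mmin : R :=
  fmin (fun wx : (W1 * W2) * (X1 * X2) => wx.2 \in supp_set g p wx.1)
       (fun wx => gain_ratio wx.1 wx.2).

Definition Mmax : R :=
  fmax (fun wx : (W1 * W2) * (X1 * X2) => wx.2 \in supp_set g p wx.1)
       (fun wx => gain_ratio wx.1 wx.2).

End Ratio.

(* Main.v *)
(** Write [V], [V1], [V2] for the three posterior vulnerabilities. Taking
    logarithms, the bounds read [Mmin * V <= V1 * V2 <= Mmax * V]. The weights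
    [p1 g1 p2 g2] and [p g] are comparable pointwise, with factors [Mmin] and
    [Mmax] (joint support makes [p1 g1 p2 g2] vanish wherever [p g] does, which
    the upper bound needs); multiplying by the channel probabilities and summing over the
    secrets, the comparison passes to the expected gain of every guess pair
    [w] and output pair [y], hence to the maxima over [w] and the sums over [y],
    both of which factor for the product weights. *)
Require Import Defs.
From mathcomp Require Import all_boot all_order all_algebra.
From mathcomp Require Import reals exp.

Set Implicit Arguments.
Unset Strict Implicit.
Unset Printing Implicit Defensive.

Import Order.TTheory GRing.Theory Num.Theory.
Local Open Scope ring_scope.

(** * Sums over pairs, logarithms and maxima *)

Lemma sum_prod_mul (R : pzSemiRingType) (I J : finType) (a : I -> R) (b : J -> R) :
  \sum_(x : I * J) a x.1 * b x.2 = (\sum_i a i) * (\sum_j b j).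
Proof. by rewrite big_distrlr /= pair_bigA. Qed.

Lemma log2M (R : realType) (x y : R) :
  0 < x -> 0 < y -> log2 (x * y) = log2 x + log2 y.
Proof. by move=> x0 y0; rewrite /log2 lnM ?posrE// mulrDl. Qed.

Lemma ler_log2 (R : realType) (x y : R) :
  0 < x -> x <= y -> log2 x <= log2 y.
Proof.
move=> x0 xy; rewrite /log2 ler_pM2r ?invr_gt0 ?ln_gt0 ?ltr1n//.
by rewrite ler_ln ?posrE// (lt_le_trans x0).
Qed.

Section FmaxAll.
Variables (R : realType) (I : finType).
Implicit Type F : I -> R.

Lemma fmax_ge F i : F i <= fmax predT F.
Proof. by have [_] := @fmaxP _ _ predT F i isT; apply. Qed.

Lemma fmax_attained F : (0 < #|I|)%N -> exists i, fmax predT F = F i.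
Proof.
by case/card_gt0P=> i0 _; have [[i _ ->] _] := @fmaxP _ _ predT F i0 isT; exists i.
Qed.

End FmaxAll.

(** * Vulnerability before and after observing the output *)

Section PosteriorVulnerability.
Variables (R : realType) (W X Y : finType).
Variables (g : W -> X -> R) (p : X -> R) (C : X -> Y -> R).

Lemma post_vuln_ge0 : (0 < #|W|)%N -> is_gain g -> (forall x, 0 <= p x) ->
  is_channel C -> 0 <= post_vuln g p C.
Proof.
move=> hW hg p0 [C0 _]; apply: sumr_ge0 => y _.
have [w ->] := fmax_attained (fun w => \sum_x p x * C x y * g w x) hW.
apply: sumr_ge0 => x _; have /andP[g0 _] := hg w x.
by rewrite !mulr_ge0.
Qed.

(** Observing an output cannot hurt: the guess that is best a priori remains available for every
    [y]. This carries the assumption [0 < vuln g p] over to the argument of the logarithm. *)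
Lemma vuln_le_post_vuln : (0 < #|W|)%N -> is_channel C ->
  vuln g p <= post_vuln g p C.
Proof.
move=> hW [_ C1]; rewrite /vuln.
have [w ->] := fmax_attained (fun w => \sum_x p x * g w x) hW.
(* Inserts the row sums [\sum_y C x y = 1]. *)
have -> : \sum_x p x * g w x = \sum_y \sum_x p x * C x y * g w x.
  rewrite exchange_big; apply: eq_bigr => x _.
  by rewrite -big_distrl -big_distrr /= C1 mulr1.
by apply: ler_sum => y _; apply: fmax_ge (fun w => \sum_x _) w.
Qed.

(** Ensures that [Mmin] and [Mmax] range over a nonempty index set, so that neither is the default
    value 0. *)
Lemma vuln_gt0_supp : (0 < #|W|)%N -> 0 < vuln g p ->
  exists w, exists x, x \in supp_set g p w.
Proof.
move=> hW; rewrite /vuln.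
have [w ->] := fmax_attained (fun w => \sum_x p x * g w x) hW => s0.
exists w; apply/existsP; apply: contraLR s0 => /existsPn h.
rewrite big1 ?ltxx// => x _.
by have := h x; rewrite inE negbK => /eqP.
Qed.

End PosteriorVulnerability.

Section Marginals.
Variables (R : realType) (X1 X2 : finType) (p : X1 * X2 -> R).
Hypothesis p0 : forall x, 0 <= p x.

Lemma marginal1_ge x : p x <= marginal1 p x.1.
Proof. by case: x => a b; rewrite /marginal1 (bigD1 b)//= lerDl sumr_ge0. Qed.

Lemma marginal2_ge x : p x <= marginal2 p x.2.
Proof. by case: x => a b; rewrite /marginal2 (bigD1 a)//= lerDl sumr_ge0. Qed.

Lemma marginal1_ge0 a : 0 <= marginal1 p a.
Proof. exact: sumr_ge0. Qed.

Lemma marginal2_ge0 b : 0 <= marginal2 p b.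
Proof. exact: sumr_ge0. Qed.

End Marginals.

(** * Pointwise comparison of product and joint weights *)

Section Comparison.
Variables (R : realType) (X1 X2 Y1 Y2 W1 W2 : finType).
Hypotheses (hW1 : (0 < #|W1|)%N) (hW2 : (0 < #|W2|)%N).
Variables (g1 : W1 -> X1 -> R) (g2 : W2 -> X2 -> R).
Variables (g : W1 * W2 -> X1 * X2 -> R) (p : X1 * X2 -> R).
Hypotheses (hg1 : is_gain g1) (hg2 : is_gain g2) (hg : is_joint_gain g1 g2 g).
Hypothesis p0 : forall x, 0 <= p x.

(** The numerator of [gain_ratio]. Comparing it with multiples of [p x * g w x] keeps the bounds
    meaningful off the support, where the ratio is not. *)
Let num (w : W1 * W2) (x : X1 * X2) : R :=
  marginal1 p x.1 * g1 w.1 x.1 * (marginal2 p x.2 * g2 w.2 x.2).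

Lemma supp_gt0 w x : x \in supp_set g p w -> 0 < p x * g w x.
Proof.
rewrite inE lt_def => -> /=; have [h _] := hg.
by have /andP[? _] := h w x; rewrite mulr_ge0.
Qed.

(** Each marginal dominates [p x], which is positive on the support, and the joint gain condition
    keeps both single gains away from 0. *)
Lemma gain_ratio_gt0 w x : x \in supp_set g p w -> 0 < gain_ratio g1 g2 g p w x.
Proof.
move=> xS; rewrite /gain_ratio divr_gt0 ?supp_gt0//.
move: xS; rewrite inE mulf_eq0 negb_or => /andP[px gx].
have px0 : 0 < p x by rewrite lt_def px p0.
have : g1 w.1 x.1 * g2 w.2 x.2 != 0.
  apply: contra gx => /eqP; case: w x {px px0} => [w1 w2] [x1 x2] /=.
  by case: hg => _ /[apply] ->.
rewrite mulf_eq0 negb_or => /andP[n1 n2].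
have /andP[? _] := hg1 w.1 x.1; have /andP[? _] := hg2 w.2 x.2.
have m1 := lt_le_trans px0 (@marginal1_ge _ _ _ p p0 x).
have m2 := lt_le_trans px0 (@marginal2_ge _ _ _ p p0 x).
by rewrite !mulr_gt0// lt_def ?n1 ?n2.
Qed.

Lemma Mmin_gt0 w x : x \in supp_set g p w -> 0 < Mmin g1 g2 g p.
Proof.
move=> xS; rewrite /Mmin.
set P := (P in fmin P _); set F := (F in fmin _ F).
have [[i Pi ->] _] := @fminP _ _ P F (w, x) xS.
exact: gain_ratio_gt0.
Qed.

Lemma Mmin_le_ratio w x : x \in supp_set g p w ->
  Mmin g1 g2 g p <= gain_ratio g1 g2 g p w x.
Proof.
move=> xS; rewrite /Mmin.
set P := (P in fmin P _); set F := (F in fmin _ F).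
by have [_ /(_ (w, x) xS)] := @fminP _ _ P F (w, x) xS.
Qed.

Lemma ratio_le_Mmax w x : x \in supp_set g p w ->
  gain_ratio g1 g2 g p w x <= Mmax g1 g2 g p.
Proof.
move=> xS; rewrite /Mmax.
set P := (P in fmax P _); set F := (F in fmax _ F).
by have [_ /(_ (w, x) xS)] := @fmaxP _ _ P F (w, x) xS.
Qed.

Lemma num_ge0 w x : 0 <= num w x.
Proof.
have /andP[? _] := hg1 w.1 x.1; have /andP[? _] := hg2 w.2 x.2.
by rewrite !mulr_ge0 ?marginal1_ge0 ?marginal2_ge0.
Qed.

Lemma Mmin_mul_le w x : Mmin g1 g2 g p * (p x * g w x) <= num w x.
Proof.
have [xS|] := boolP (x \in supp_set g p w); last first.
  by rewrite inE negbK => /eqP ->; rewrite mulr0 num_ge0.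
by rewrite -ler_pdivlMr ?supp_gt0//; exact: Mmin_le_ratio.
Qed.

Lemma le_Mmax_mul w x : jointly_supported p ->
  num w x <= Mmax g1 g2 g p * (p x * g w x).
Proof.
move=> hj; have [xS|] := boolP (x \in supp_set g p w).
  by rewrite -ler_pdivrMr ?supp_gt0//; exact: ratio_le_Mmax.
(* Off the support [num] must vanish. Regrouped as marginals times gains, it does: [p x = 0] kills
   the marginals by joint support, and [g w x = 0] kills the gains. *)
rewrite inE negbK => /eqP pg0; rewrite pg0 mulr0 /num mulrACA.
case: w x pg0 => [w1 w2] [x1 x2] /= /eqP; rewrite mulf_eq0 => /orP[/eqP px|/eqP gx].
  suff /eqP -> : marginal1 p x1 * marginal2 p x2 == 0 by rewrite mul0r.
  by apply: contraT => /hj; rewrite px eqxx.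
by have [_ /(_ w1 w2 x1 x2) [/(_ gx) -> _]] := hg; rewrite mulr0.
Qed.

(** * From weights to posterior vulnerabilities *)

Variables (C1 : X1 -> Y1 -> R) (C2 : X2 -> Y2 -> R).
Hypotheses (hC1 : is_channel C1) (hC2 : is_channel C2).

Let gain1 y w := \sum_x marginal1 p x * C1 x y * g1 w x.
Let gain2 y w := \sum_x marginal2 p x * C2 x y * g2 w x.
Let gain12 y w := \sum_x p x * parallel C1 C2 x y * g w x.

Lemma gain_mulE y w :
  gain1 y.1 w.1 * gain2 y.2 w.2 = \sum_x parallel C1 C2 x y * num w x.
Proof.
rewrite -sum_prod_mul; apply: eq_bigr => x _.
rewrite [marginal1 p _ * _]mulrC [marginal2 p _ * _]mulrC.
by rewrite -(mulrA (C1 _ _)) -(mulrA (C2 _ _)) mulrACA.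
Qed.

Lemma parallel_ge0 x y : 0 <= parallel C1 C2 x y.
Proof. by rewrite mulr_ge0 ?hC1.1 ?hC2.1. Qed.

Lemma gain1_ge0 y w : 0 <= gain1 y w.
Proof.
apply: sumr_ge0 => x _; have /andP[? _] := hg1 w x.
by rewrite !mulr_ge0 ?marginal1_ge0 ?hC1.1.
Qed.

Lemma gain2_ge0 y w : 0 <= gain2 y w.
Proof.
apply: sumr_ge0 => x _; have /andP[? _] := hg2 w x.
by rewrite !mulr_ge0 ?marginal2_ge0 ?hC2.1.
Qed.

Lemma post_vuln_mulE :
  post_vuln g1 (marginal1 p) C1 * post_vuln g2 (marginal2 p) C2 =
  \sum_(y : Y1 * Y2) fmax predT (gain1 y.1) * fmax predT (gain2 y.2).
Proof.
by rewrite (sum_prod_mul (fun y => fmax predT (gain1 y))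
                         (fun y => fmax predT (gain2 y))).
Qed.

Lemma Mmin_post_vuln_le : Mmin g1 g2 g p * post_vuln g p (parallel C1 C2) <=
  post_vuln g1 (marginal1 p) C1 * post_vuln g2 (marginal2 p) C2.
Proof.
rewrite post_vuln_mulE mulr_sumr; apply: ler_sum => y _.
have hW : (0 < #|{: W1 * W2}|)%N by rewrite card_prod muln_gt0 hW1.
(* The components of the best joint guess are merely candidates in the two separate maxima. *)
have [w ->] := fmax_attained (gain12 y) hW.
apply: (@le_trans _ _ (gain1 y.1 w.1 * gain2 y.2 w.2)); last first.
  by rewrite ler_pM ?gain1_ge0 ?gain2_ge0 ?fmax_ge.
rewrite gain_mulE mulr_sumr; apply: ler_sum => x _.
rewrite [p x * _]mulrC -mulrA mulrCA.
by rewrite ler_wpM2l ?parallel_ge0 ?Mmin_mul_le.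
Qed.

Lemma le_Mmax_post_vuln : 0 <= Mmax g1 g2 g p -> jointly_supported p ->
  post_vuln g1 (marginal1 p) C1 * post_vuln g2 (marginal2 p) C2 <=
  Mmax g1 g2 g p * post_vuln g p (parallel C1 C2).
Proof.
move=> M0 hj; rewrite post_vuln_mulE mulr_sumr; apply: ler_sum => y _.
(* Conversely, the two separately optimal guesses form a candidate pair for the joint maximum. *)
have [w1 ->] := fmax_attained (gain1 y.1) hW1.
have [w2 ->] := fmax_attained (gain2 y.2) hW2.
apply: (@le_trans _ _ (Mmax g1 g2 g p * gain12 y (w1, w2))); last first.
  by rewrite ler_wpM2l ?(fmax_ge (gain12 y)).
rewrite (gain_mulE y (w1, w2)) mulr_sumr; apply: ler_sum => x _.
rewrite [p x * _]mulrC -[in leRHS]mulrA [leRHS]mulrCA.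
by rewrite ler_wpM2l ?parallel_ge0 ?le_Mmax_mul.
Qed.

End Comparison.

Theorem lemma3p7 (R : realType) (X1 X2 Y1 Y2 W1 W2 : finType)
  (hX1 : (0 < #|X1|)%N) (hX2 : (0 < #|X2|)%N)
  (hY1 : (0 < #|Y1|)%N) (hY2 : (0 < #|Y2|)%N)
  (hW1 : (0 < #|W1|)%N) (hW2 : (0 < #|W2|)%N)
  (g1 : W1 -> X1 -> R) (g2 : W2 -> X2 -> R)
  (g : W1 * W2 -> X1 * X2 -> R)
  (hg1 : is_gain g1) (hg2 : is_gain g2) (hg : is_joint_gain g1 g2 g)
  (p : X1 * X2 -> R) (hp : is_prior p) (hV : 0 < vuln g p)
  (C1 : X1 -> Y1 -> R) (C2 : X2 -> Y2 -> R)
  (hC1 : is_channel C1) (hC2 : is_channel C2) :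
  post_entropy g p (parallel C1 C2)
    >= post_entropy g1 (marginal1 p) C1 + post_entropy g2 (marginal2 p) C2
       + log2 (Mmin g1 g2 g p)
  /\
  (jointly_supported p ->
   post_entropy g p (parallel C1 C2)
     <= post_entropy g1 (marginal1 p) C1 + post_entropy g2 (marginal2 p) C2
        + log2 (Mmax g1 g2 g p)).
Proof.
have [p0 _] := hp.
have hW : (0 < #|{: W1 * W2}|)%N by rewrite card_prod muln_gt0 hW1.
have [w [x xS]] := vuln_gt0_supp hW hV.
have m0 : 0 < Mmin g1 g2 g p by exact: Mmin_gt0 xS.
have M0 : 0 < Mmax g1 g2 g p.
  by apply: lt_le_trans (ratio_le_Mmax g1 g2 xS); apply: gain_ratio_gt0.
have hC : is_channel (parallel C1 C2).
  split=> [a b|a]; first exact: parallel_ge0.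
  by rewrite (sum_prod_mul (C1 a.1) (C2 a.2)) hC1.2 hC2.2 mulr1.
have V0 := lt_le_trans hV (vuln_le_post_vuln g p hW hC).
have mV := Mmin_post_vuln_le hW1 hW2 hg1 hg2 hg p0 hC1 hC2.
(* Splitting the logarithms needs [V1] and [V2] positive. The lower bound itself gives
   [V1 * V2 >= Mmin * V > 0], so neither nonnegative factor vanishes. *)
have := lt_le_trans (mulr_gt0 m0 V0) mV.
have V1_ge0 : 0 <= post_vuln g1 (marginal1 p) C1.
  by apply: post_vuln_ge0 => // ?; exact: marginal1_ge0.
have V2_ge0 : 0 <= post_vuln g2 (marginal2 p) C2.
  by apply: post_vuln_ge0 => // ?; exact: marginal2_ge0.
move=> /[dup] V12_gt0; rewrite lt0r mulf_eq0 negb_or => /andP[/andP[V1n V2n] _].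
have V1_gt0 : 0 < post_vuln g1 (marginal1 p) C1 by rewrite lt0r V1n.
have V2_gt0 : 0 < post_vuln g2 (marginal2 p) C2 by rewrite lt0r V2n.
rewrite /post_entropy -opprD -log2M//; split=> [|hj].
  rewrite addrC lerBlDr addrC lerBrDr -log2M//.
  by apply: ler_log2; rewrite ?mulr_gt0.
rewrite addrC lerBrDr addrC lerBlDr -log2M//.
by apply: ler_log2 => //; apply: le_Mmax_post_vuln => //; exact: ltW.
Qed.
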